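(* Let $n\ge p\ge 1$, let $\mathbf{A}$ have the Wishart distribution $W(\mathbf{I},n)$ (that is, $\Sigma=\mathbf{I}$), let $\phi(\mathbf{A})$ be an estimator with values in the space $\mathcal{P}_p$ of $p\times p$ positive definite symmetric matrices, and let $\lambda_i$ denote the $i$-th largest eigenvalue of $\phi(\mathbf{A})$, $i=1,\dots,p$. For $\mathbf{d}=(d_1,\dots,d_p)'$ with positive constants $d_i$, consider the geodesic distance loss function on $\mathcal{P}_p$, $$L_G(\phi(\mathbf{A}),\mathbf{I})=\sum_{i=1}^p\log^2(d_i\lambda_i),$$ with risk function $R_G(\hat\Sigma_G,\mathbf{I})=\mathcal{E}\big[\sum_{i=1}^p\log^2(d_i\lambda_i)\big]$, regarded as a function of $\mathbf{d}$. Let $$\mathcal{C}=\{\mathbf{d}\;:\;\mathcal{E}[d_i\lambda_i]\le e,\ \forall i=1,\dots,p\}.$$ Then on the set $\mathcal{C}$ the minimum of the risk function $R_G(\hat\Sigma_G,\mathbf{I})$ occurs at $d_i=\exp\{-\mathcal{E}[\log\lambda_i]\}$ for all $i=1,\dots,p$, and the minimum risk is $\sum_{i=1}^p\mathrm{Var}[\log\lambda_i]$.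
   Context: $\mathbf{A}=\sum_{i=1}^n\mathbf{X}_i\mathbf{X}_i'$ with $\mathbf{X}_1,\dots,\mathbf{X}_n$ independent $N_p(\mathbf{0},\Sigma)$, $n\ge p$, so $\mathbf{A}\sim W(\Sigma,n)$ is positive definite with probability one. The geodesic distance loss for an estimator of $\Sigma$ is in general the sum of squared logarithms of the eigenvalues of $\Sigma^{-1}\phi(\mathbf{A})$; here $\Sigma=\mathbf{I}$ and the eigenvalues are rescaled by the constants $d_i$. $\hat\Sigma_G$ denotes the corresponding (rescaled) estimator. $\mathcal{E}$ and $\mathrm{Var}$ denote expectation and variance, and $e=\exp(1)$.
   Formalization: The point d_i = exp{-E[log λ_i]} need not lie in C (e.g. p = n = 1, φ(A) = A), so that it is the minimizer on C is stated only when it lies in C; that its risk is the sum of variances and is at most the risk of every d in C is stated without this condition. *)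

(* Defs.v *)
From mathcomp Require Import all_boot all_order all_algebra.
From mathcomp Require Import all_classical all_reals all_analysis.

Set Implicit Arguments.
Unset Strict Implicit.
Unset Printing Implicit Defensive.

Import Order.TTheory GRing.Theory Num.Theory.
Import numFieldNormedType.Exports.

Local Open Scope classical_set_scope.
Local Open Scope ring_scope.

(* The sigma-algebra on matrices generated by the entries; it is the Borel
   sigma-algebra of R^(m * n). *)
Definition mx_cylinders (R : realType) (m n : nat) : set (set 'M[R]_(m, n)) :=
  \bigcup_(ij in [set: 'I_m * 'I_n])
    preimage_set_system setT (fun M : 'M[R]_(m, n) => M ij.1 ij.2) measurable.

Notation borel_mx R m n := (g_sigma_algebraType (@mx_cylinders R m n)).

Section random_matrices.
Context {R : realType}.

Definition posdef (p : nat) (M : 'M[R]_p) : Prop :=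
  M^T = M /\ forall v : 'cV[R]_p, v != 0 -> 0 < (v^T *m M *m v) 0 0.

(* The nonincreasing sequence of the roots of the characteristic polynomial,
   with multiplicity; it is unique when it exists, in particular it exists for
   every symmetric M. *)
Definition eigenvalues (p : nat) (M : 'M[R]_p) : seq R :=
  xget [::] [set s | sorted >=%R s /\
                     char_poly M = \prod_(x <- s) ('X - x%:P)].

(* [eigval M i] is the (i+1)-th largest eigenvalue, since 'I_p starts at 0. *)
Definition eigval (p : nat) (M : 'M[R]_p) (i : 'I_p) : R := (eigenvalues M)`_i.

Section probability.
Context {d : measure_display} {T : measurableType d} (P : probability T R).

(* X ~ N_p(mu, Sigma) for a positive definite Sigma: every nonzero linear form
   t'X is N(t'mu, t'Sigma t).  The second parameter of [normal_prob] is the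
   standard deviation, nonzero here because t != 0. *)
Definition mvnormal (p : nat) (X : T -> 'cV[R]_p) (mu : 'cV[R]_p)
    (Sigma : 'M[R]_p) : Prop :=
  [/\ posdef Sigma,
      measurable_fun setT (X : T -> borel_mx R p 1) &
      forall t : 'cV[R]_p, t != 0 ->
      forall B : set R, measurable B ->
        P [set w | B ((t^T *m X w) 0 0)] =
        normal_prob ((t^T *m mu) 0 0)
                    (Num.sqrt ((t^T *m Sigma *m t) 0 0)) B].

(* The product rule for subfamilies is the case where the other B i are setT. *)
Definition mutually_independent (p n : nat) (X : 'I_n -> T -> 'cV[R]_p) : Prop :=
  forall B : 'I_n -> set (borel_mx R p 1), (forall i, measurable (B i)) ->
    P (\bigcap_(i in [set: 'I_n]) (X i @^-1` B i)) =
    (\prod_(i < n) P (X i @^-1` B i))%E.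

Definition scatter (p n : nat) (X : 'I_n -> T -> 'cV[R]_p) (w : T) : 'M[R]_p :=
  \sum_(i < n) X i w *m (X i w)^T.

End probability.

(* A ~ W(Sigma, n): A has the law of the scatter matrix of n independent
   N_p(0, Sigma) vectors, which may live on another probability space. *)
Definition wishart {d : measure_display} {T : measurableType d}
    (P : probability T R) (p n : nat) (A : T -> 'M[R]_p) (Sigma : 'M[R]_p) :
    Prop :=
  measurable_fun setT (A : T -> borel_mx R p p) /\
  exists (d' : measure_display) (T' : measurableType d')
         (P' : probability T' R) (X : 'I_n -> T' -> 'cV[R]_p),
    [/\ forall i, mvnormal P' (X i) 0 Sigma,
        mutually_independent P' X &
        forall S : set (borel_mx R p p), measurable S ->
          P (A @^-1` S) = P' (scatter X @^-1` S)].

(* The geodesic loss L_G(S, I), with the eigenvalues of S rescaled by c. *)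
Definition geodesic_loss (p : nat) (c : 'I_p -> R) (S : 'M[R]_p) : R :=
  \sum_(i < p) ln (c i * eigval S i) ^+ 2.

Section risk.
Context {d : measure_display} {T : measurableType d} (P : probability T R).
Context {p : nat} (W : T -> 'M[R]_p).

Definition geodesic_risk (c : 'I_p -> R) : \bar R :=
  'E_P[fun w => geodesic_loss c (W w)].

Definition feasible : set ('I_p -> R) :=
  [set c | (forall i, 0 < c i) /\
           (forall i, 'E_P[fun w => (c i * eigval (W w) i)%R] <=
                      (expR 1)%:E)%E].

Definition log_eigval (i : 'I_p) (w : T) : R := ln (eigval (W w) i).

(* When the expectation is not finite, [fine] makes this constant 1; then
   log_eigval i is not square integrable and the risk is +oo at every c > 0. *)
Definition optimal_scale (i : 'I_p) : R := expR (- fine 'E_P[log_eigval i]).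

End risk.

Definition minimum_on (D : Type) (C : set D) (f : D -> \bar R) (x : D)
    (v : \bar R) : Prop :=
  [/\ C x, f x = v & forall y, C y -> (v <= f y)%E].

End random_matrices.

(* Main.v *)
(* The risk at c is the sum over i of E[(Y_i + ln c_i)^2] with
   Y_i = log lambda_i, and each summand is least, with value Var[Y_i], at
   ln c_i = - E[Y_i]; if Y_i is not square integrable, both sides are +oo.
   Additivity of the expectation needs the Y_i to be measurable.  For a positive
   definite M with eigenvalues lambda_0 >= lambda_1 >= ..., log lambda_k is the
   limit of m^-1 ln (tr M^m - \sum_(i < k) lambda_i^m), so measurability follows
   by induction on k.  Off the almost sure event where phi(A) is positive definite
   nothing is known about the eigenvalues, but the integral of the library does not
   depend on the values on a null set, even for non-measurable integrands. *)
Require Import Defs.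
From mathcomp Require Import all_boot all_order all_algebra.
From mathcomp Require Import complex.
From mathcomp Require Import all_classical all_reals all_analysis.
From mathcomp Require Import measurable_realfun.

Set Implicit Arguments.
Unset Strict Implicit.
Unset Printing Implicit Defensive.

Import Order.TTheory GRing.Theory Num.Theory.
Import numFieldNormedType.Exports.

Local Open Scope classical_set_scope.
Local Open Scope ring_scope.

(** * Similarity of matrices and the real spectrum of a symmetric matrix *)

Lemma char_poly_similar (F : fieldType) (n : nat) (Q M : 'M[F]_n) :
  Q \in unitmx -> char_poly (invmx Q *m M *m Q) = char_poly M.
Proof.
move=> Qu; rewrite /char_poly /char_poly_mx.
have QVQ : map_mx polyC (invmx Q) *m map_mx polyC Q = 1%:M.
  by rewrite -map_mxM mulVmx // map_mx1.
have -> : 'X%:M - map_mx polyC (invmx Q *m M *m Q) =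
    map_mx polyC (invmx Q) *m ('X%:M - map_mx polyC M) *m map_mx polyC Q.
  rewrite mulmxBr mulmxBl !map_mxM; congr (_ - _).
  by rewrite scalar_mxC -mulmxA QVQ mulmx1.
by rewrite !det_mulmx mulrAC -det_mulmx QVQ det1 mul1r.
Qed.

Lemma expmx_similar (F : fieldType) (n : nat) (Q M : 'M[F]_n) (m : nat) :
  Q \in unitmx -> (invmx Q *m M *m Q) ^+ m = invmx Q *m M ^+ m *m Q.
Proof.
move=> Qu; elim: m => [|m IH]; first by rewrite !expr0 mulmx1 mulVmx.
by rewrite !exprS IH -!mulmxE !mulmxA mulmxK.
Qed.

Lemma expmx_diag (F : fieldType) (n : nat) (D : 'rV[F]_n) (m : nat) :
  (diag_mx D) ^+ m = diag_mx (\row_i D 0 i ^+ m).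
Proof.
elim: m => [|m IH].
  rewrite expr0; apply/matrixP => i j; rewrite !mxE.
  by case: eqP => [->|]; rewrite ?mulr1n ?mulr0n.
rewrite exprS IH -mulmxE mulmx_diag; congr diag_mx.
by apply/rowP => i; rewrite !mxE exprS.
Qed.

(** Over the complex numbers [M] is Hermitian, hence unitarily diagonalizable with real diagonal.
    Characteristic polynomial and traces of powers are similarity invariants, and the two identities
    descend along the injective map [real_complex]. *)
Lemma symmetric_spectrum (R : rcfType) (p : nat) (M : 'M[R]_p) : M^T = M ->
  exists s : p.-tuple R,
    char_poly M = \prod_(x <- s) ('X - x%:P) /\
    forall m, \tr (M ^+ m) = \sum_(x <- s) x ^+ m.
Proof.
move=> sM; pose f := real_complex R; pose Mc := map_mx f M.
have McT : Mc^T = Mc by apply/matrixP => i j; rewrite !mxE -[in RHS]sM mxE.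
have realMc : Mc \is a mxOver Num.real.
  by apply/mxOverP => i j; rewrite mxE complex_real.
have hM : Mc \is hermsymmx.
  apply: realsym_hermsym => //; apply/is_hermitianmxP.
  by rewrite expr0 scale1r McT map_mx_id.
have /orthomx_spectralP := hermitian_normalmx hM.
have := hermitian_spectral_diag_real hM.
have := spectral_unit Mc.
move: (spectralmx Mc) (spectral_diag Mc) => Q D Qu Dr eM.
pose d (i : 'I_p) := complex.Re (D 0 i).
have dE i : D 0 i = f (d i).
  by rewrite /f /d RRe_real //; apply: (mxOverP Dr).
exists [tuple d i | i < p]; split.
  apply: (map_poly_inj f); rewrite map_char_poly -/Mc eM char_poly_similar //.
  rewrite char_poly_trig; last exact: diag_mx_is_trig.
  rewrite rmorph_prod big_map big_enum /=; apply: eq_bigr => i _.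
  by rewrite map_polyXsubC mxE eqxx mulr1n dE.
move=> m; apply: (fmorph_inj f).
rewrite -trace_map_mx; have -> : map_mx f (M ^+ m) = Mc ^+ m.
  elim: m => [|m IH]; first by rewrite !expr0 map_mx1.
  by rewrite !exprS -!mulmxE map_mxM IH.
rewrite eM expmx_similar // mxtrace_mulC mulKVmx // expmx_diag mxtrace_diag.
rewrite rmorph_sum big_map big_enum /=; apply: eq_bigr => i _.
by rewrite mxE dE rmorphXn.
Qed.

(** * Ordered eigenvalues of symmetric and positive definite matrices *)

Section eigenvalues_theory.
Context {R : realType} {p : nat}.
Implicit Types M : 'M[R]_p.

Lemma eigenvaluesP M : M^T = M ->
  sorted >=%R (eigenvalues M) /\
  char_poly M = \prod_(x <- eigenvalues M) ('X - x%:P).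
Proof.
move=> /symmetric_spectrum[s [sE _]].
(* The default [[::]] is excluded because sorting [s] gives a witness. *)
rewrite /eigenvalues; case: xgetP => [? -> //|] /(_ (sort >=%R s)) [].
split; first by apply: sort_sorted => x y; exact: le_total.
by rewrite sE; apply: perm_big; rewrite perm_sym perm_sort.
Qed.

Lemma size_eigenvalues M : M^T = M -> size (eigenvalues M) = p.
Proof.
move=> /eigenvaluesP[_ /(congr1 (fun q : {poly R} => size q))].
by rewrite size_char_poly size_prod_XsubC => -[].
Qed.

Lemma mxtrace_exp_eigenvalues M m : M^T = M ->
  \tr (M ^+ m) = \sum_(i < p) eigval M i ^+ m.
Proof.
move=> sM; have [s [sE ->]] := symmetric_spectrum sM.
(* Unique factorization makes [s] a permutation of the chosen eigenvalues, so power sums agree. *)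
have [_] := eigenvaluesP sM; rewrite sE => /prod_XsubC_eq st.
rewrite (perm_big _ st) /=.
by rewrite (big_nth 0) big_mkord size_eigenvalues.
Qed.

Lemma posdef_eigval_gt0 M i : posdef M -> 0 < eigval M i.
Proof.
move=> [sM pM]; have [_ cM] := eigenvaluesP sM.
have : root (char_poly M) (eigval M i).
  by rewrite cM root_prod_XsubC mem_nth // size_eigenvalues.
rewrite -eigenvalue_root_char => /eigenvalueP [v vM v0].
(* The eigenvector [v] is a row, hence the transpose; the form at [v^T] is the eigenvalue times a
   sum of squares. *)
have := pM v^T; rewrite trmx_eq0 trmxK vM -scalemxAl mxE => /(_ v0).
move=> h; rewrite ltNge; apply/negP => e0; move: h; rewrite ltNge => /negP; apply.
rewrite mulr_le0_ge0 // mxE sumr_ge0 // => j _.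
by rewrite !mxE -expr2 sqr_ge0.
Qed.

Lemma eigval_homo M (i j : 'I_p) : M^T = M -> (i <= j)%N ->
  eigval M j <= eigval M i.
Proof.
move=> sM ij; have [so _] := eigenvaluesP sM.
apply: (sorted_leq_nth _ _ 0 so) ij.
- by move=> x y z /= yx xz; apply: le_trans xz yx.
- exact: lexx.
- by rewrite inE size_eigenvalues.
- by rewrite inE size_eigenvalues.
Qed.

End eigenvalues_theory.

(** The sum lies between [a k ^+ m.+1] and [p%:R * a k ^+ m.+1], so the error is at most [ln p%:R]
    divided by [m.+1]. The shifted exponent avoids division by zero. *)
Lemma cvg_ln_power_sum {R : realType} (p : nat) (a : 'I_p -> R) (k : 'I_p) :
  (forall i, 0 < a i) -> (forall i : 'I_p, (k <= i)%N -> a i <= a k) ->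
  m.+1%:R^-1 * ln (\sum_(i < p | (k <= i)%N) a i ^+ m.+1) @[m --> \oo]
    --> ln (a k).
Proof.
move=> a0 ak.
have p0 : (0 < p%:R :> R) by rewrite ltr0n (leq_ltn_trans _ (ltn_ord k)).
pose S m := \sum_(i < p | (k <= i)%N) a i ^+ m.+1.
have lS m : a k ^+ m.+1 <= S m.
  rewrite /S (bigD1 k) //= lerDl sumr_ge0 // => i _.
  by rewrite exprn_ge0 // ltW.
have uS m : S m <= p%:R * a k ^+ m.+1.
  apply: (@le_trans _ _ (\sum_(i < p | (k <= i)%N) a k ^+ m.+1)).
    apply: ler_sum => i ki.
    by apply: lerXn2r; rewrite ?nnegrE ?(ltW (a0 _)) // ak.
  apply: (@le_trans _ _ (\sum_(i < p) a k ^+ m.+1)).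
    rewrite [leRHS](bigID (fun i : 'I_p => (k <= i)%N)) /= lerDl sumr_ge0 // => i _.
    by rewrite exprn_ge0 // ltW.
  by rewrite sumr_const card_ord mulr_natl.
apply: (@squeeze_cvgr _ _ _ _ (fun=> ln (a k))
  (fun m => m.+1%:R^-1 * ln p%:R + ln (a k))).
- near=> m.
  have ap : 0 < a k ^+ m.+1 by rewrite exprn_gt0.
  have E : ln (a k) = m.+1%:R^-1 * ln (a k ^+ m.+1).
    by rewrite lnXn // -[ln _ *+ _]mulr_natl mulKf // pnatr_eq0.
  rewrite [X in X <= _ <= _]E [X in _ <= _ <= _ + X]E -mulrDr -lnM ?posrE //.
  rewrite !ler_pM2l ?invr_gt0 ?ltr0n // !ler_ln ?posrE ?mulr_gt0 //.
  + by rewrite lS uS.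
  + exact: lt_le_trans ap (lS m).
  + exact: lt_le_trans ap (lS m).
- exact: cvg_cst.
- rewrite -[X in _ --> X]add0r; apply: cvgD; last exact: cvg_cst.
  rewrite -(mul0r (ln p%:R)); apply: cvgM; last exact: cvg_cst.
  exact: cvg_harmonic.
Unshelve. all: by end_near.
Qed.

(** * Measurability of the logarithms of the eigenvalues *)

Section measurability.
Context {R : realType} {d : measure_display} {T : measurableType d}.

Lemma measurable_mx_entry (m n : nat) (W : T -> 'M[R]_(m, n)) i j :
  measurable_fun setT (W : T -> borel_mx R m n) ->
  measurable_fun setT (fun w => W w i j).
Proof.
move=> mW _ B mB; have := mW measurableT [set M | B (M i j)].
apply; apply: sub_sigma_algebra; exists (i, j) => //.
by exists B => //; rewrite setTI.
Qed.

Lemma measurable_mxtrace_exp (p : nat) (W : T -> 'M[R]_p) m :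
  (forall i j, measurable_fun setT (fun w => W w i j)) ->
  measurable_fun setT (fun w => \tr (W w ^+ m)).
Proof.
move=> mW; suff mWm i j : measurable_fun setT (fun w => (W w ^+ m) i j).
  by apply: measurable_sum => i.
elim: m i j => [|m IH] i j.
  by under eq_fun do rewrite expr0 mxE; exact: measurable_cst.
under eq_fun do rewrite exprS -mulmxE mxE.
by apply: measurable_sum => l; apply: measurable_funM.
Qed.

Lemma measurable_log_eigval (p : nat) (W : T -> 'M[R]_p) (D : set T) k :
  measurable D -> measurable_fun setT (W : T -> borel_mx R p p) ->
  (forall w, D w -> posdef (W w)) -> measurable_fun D (log_eigval W k).
Proof.
move=> mD mW pW.
have mtr m : measurable_fun D (fun w => \tr (W w ^+ m)).
  apply: measurable_funTS; apply: measurable_mxtrace_exp => i j.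
  exact: measurable_mx_entry.
have [j] := ubnP k; elim: j k => // j IH k; rewrite ltnS => kj.
(* The larger eigenvalues enter as exponentials of multiples of [log_eigval W i], so that the
   induction hypothesis applies to them directly. *)
pose h m w := m.+1%:R^-1 * ln (\tr (W w ^+ m.+1) -
  \sum_(i < p | (i < k)%N) expR (log_eigval W i w *+ m.+1)).
apply: (measurable_fun_cvg (h := h)) => [m|w Dw].
  apply: measurable_funM; first exact: measurable_cst.
  apply: measurableT_comp; first exact: measurable_ln.
  apply: measurable_funB => //.
  under eq_fun do rewrite big_mkcond /=.
  apply: measurable_sum => i; case: (ltnP i k) => [ik|_]; last exact: measurable_cst.
  apply: measurableT_comp; first exact: measurable_expR.
  under eq_fun do rewrite -[_ *+ _]mulr_natl.
  apply: measurable_funM; first exact: measurable_cst.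
  exact: IH (leq_trans ik kj).
(* On [D] the difference inside [h] is the power sum of the eigenvalues of index at least [k]. *)
have [sW _] := pW _ Dw; have e0 i := posdef_eigval_gt0 i (pW _ Dw).
have := @cvg_ln_power_sum _ _ _ k e0 (fun i => eigval_homo (i := k) sW).
apply: cvg_trans; apply: near_eq_cvg; near=> m.
have trE : \tr (W w ^+ m.+1) = \sum_(i < p | (i < k)%N) eigval (W w) i ^+ m.+1 +
    \sum_(i < p | (k <= i)%N) eigval (W w) i ^+ m.+1.
  rewrite mxtrace_exp_eigenvalues // (bigID (fun i : 'I_p => (i < k)%N)) /=.
  by congr (_ + _); apply: eq_bigl => i; rewrite -leqNgt.
have expE : \sum_(i < p | (i < k)%N) expR (log_eigval W i w *+ m.+1) =
    \sum_(i < p | (i < k)%N) eigval (W w) i ^+ m.+1.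
  by apply: eq_bigr => i _; rewrite -lnXn // lnK // posrE exprn_gt0.
by rewrite /h trE expE [X in X - _]addrC addrK.
Unshelve. all: by end_near.
Qed.

End measurability.

Import HBNNSimple.

(** * Expectations of almost surely equal functions, and the variance as least mean square *)

Section ae_eq_expectation.
Context {d : measure_display} {T : measurableType d} {R : realType}.
Local Open Scope ereal_scope.

(* The integral of a nonnegative function, measurable or not, is a supremum over
   the simple functions below it, and these can be cut off on N. *)
Lemma le_integral_off_null (mu : {measure set T -> \bar R})
    (f g : T -> \bar R) (N : set T) :
  measurable N -> mu N = 0 -> (forall x, 0 <= f x) -> (forall x, 0 <= g x) ->
  (forall x, ~ N x -> f x <= g x) -> \int[mu]_x f x <= \int[mu]_x g x.
Proof.
move=> mN N0 f0 g0 fg; rewrite !ge0_integralTE//.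
apply: ge_ereal_sup => _ [h /= hf <-].
have mNC : measurable (~` N) by exact: measurableC.
have -> : sintegral mu h = sintegral mu (proj_nnsfun h mNC).
  rewrite -!integralT_nnsfun; apply: ge0_ae_eq_integral => //.
  - exact/measurable_EFinP.
  - exact/measurable_EFinP.
  - by move=> x _; rewrite lee_fin.
  - by move=> x _; rewrite lee_fin.
  exists N; split => // x /= hx; apply: contrapT => Nx; apply: hx => _.
  by rewrite mindicE mem_set ?mulr1.
apply: ereal_sup_ubound; exists (proj_nnsfun h mNC) => //= x.
rewrite mindicE; have [Nx|Nx] := pselect (N x).
  by rewrite memNset ?mulr0//; apply.
by rewrite mem_set ?mulr1// (le_trans (hf x))// fg.
Qed.

(** Positive and negative parts reduce this to nonnegative functions, which are compared in both
    directions off the null set. *)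
Lemma ae_eq_expectation (P : probability T R) (X Y : T -> R) :
  {ae P, forall w, X w = Y w} -> 'E_P[X] = 'E_P[Y].
Proof.
move=> [N [mN N0 XY]].
have eqN x : ~ N x -> X x = Y x by move=> Nx; apply: contrapT => /XY.
rewrite !unlock integralE [RHS]integralE; congr (_ - _).
  by apply/eqP; rewrite eq_le; apply/andP; split;
    apply: (le_integral_off_null mN) => // x /eqN; rewrite !funeposE => ->.
by apply/eqP; rewrite eq_le; apply/andP; split;
  apply: (le_integral_off_null mN) => // x /eqN; rewrite !funenegE => ->.
Qed.

Lemma Lfun2_sqr (mu : {measure set T -> \bar R}) (f : T -> R) :
  measurable_fun setT f -> \int[mu]_w (f w ^+ 2)%:E < +oo ->
  f \in Lfun mu 2%:E.
Proof.
move=> mf fin; rewrite inE; apply/andP; split; rewrite inE//=.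
rewrite /finite_norm unlock poweR_lty//=.
under eq_integral => x _ do rewrite powR_mulrn// real_normK ?num_real//.
exact: fin.
Qed.

(** True by definition, also for an infinite expectation, where [fine] gives 0. As [optimal_scale]
    is centred by the same [fine], its risk is the sum of variances without a case distinction. *)
Lemma varianceEfine (P : probability T R) (X : T -> R) :
  'V_P[X] = 'E_P[fun w => ((X w - fine 'E_P[X]) ^+ 2)%R].
Proof. by rewrite /variance unlock. Qed.

(** With [Y] equal to [X] minus [c], the gap between the two sides is the square of the expectation
    of [Y]. If [Y] is not square integrable, the right side is [+oo]. *)
Lemma variance_le (P : probability T R) (X : T -> R) (c : R) :
  measurable_fun setT X -> 'V_P[X] <= 'E_P[fun w => ((X w - c) ^+ 2)%R].
Proof.
move=> mX; set Y := (X \- cst c)%R.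
have mY : measurable_fun setT Y by exact: measurable_funB.
have [fin|] := ltP ('E_P[fun w => (Y w ^+ 2)%R]) +oo; last first.
  by rewrite leye_eq => /eqP ->; exact: leey.
have Y2 : Y \in Lfun P 2%:E by apply: Lfun2_sqr => //; move: fin; rewrite unlock.
have -> : X = (Y \+ cst c)%R by apply/funext => w; rewrite /Y /= subrK.
rewrite varianceD_cst_r// varianceE//.
have -> : (fun w => ((Y \+ cst c) w - c) ^+ 2)%R = (Y ^+ 2)%R.
  by apply/funext => w; rewrite /= addrK.
rewrite leeBlDr; last first.
  by rewrite fin_numX// expectation_fin_num// Lfun_subset12 ?fin_num_measure.
by rewrite leeDl// sqre_ge0.
Qed.

End ae_eq_expectation.

(** * The risk as a sum of mean squares, one for each eigenvalue *)

Section risk_decomposition.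
Context {R : realType} {d : measure_display} {T : measurableType d}.
Context (P : probability T R) {p : nat} (W : T -> 'M[R]_p).
Hypothesis mW : measurable_fun setT (W : T -> borel_mx R p p).
Hypothesis pW : {ae P, forall w, posdef (W w)}.

(** The version [Z] is set to 0 on a measurable null set outside of which [W] is positive
    definite. *)
Lemma measurable_log_eigval_version :
  exists Z : 'I_p -> T -> R, (forall i, measurable_fun setT (Z i)) /\
    {ae P, forall w, posdef (W w) /\ forall i, log_eigval W i w = Z i w}.
Proof.
have [N [mN N0 WN]] := pW.
have mNC : measurable (~` N) by exact: measurableC.
have pN w : ~ N w -> posdef (W w) by move=> Nw; apply: contrapT => /WN.
exists (fun i => log_eigval W i \_ (~` N)); split.
  move=> i; apply/(measurable_restrictT (log_eigval W i) mNC).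
  exact: (measurable_log_eigval i mNC mW pN).
exists N; split => // w /= ZN; apply: contrapT => Nw; apply: ZN.
by split => [|i]; [exact: pN | rewrite patchE mem_set].
Qed.

Lemma geodesic_riskE (c : 'I_p -> R) : (forall i, 0 < c i) ->
  geodesic_risk P W c =
  (\sum_(i < p) 'E_P[fun w => ((log_eigval W i w + ln (c i)) ^+ 2)%R])%E.
Proof.
move=> c0; have [Z [mZ WZ]] := measurable_log_eigval_version.
(* Passing to [Z] makes the summands measurable, as exchanging sum and integral requires; each
   summand is then carried back to [log_eigval]. *)
have -> : geodesic_risk P W c =
    ('E_P[fun w => (\sum_(i < p) (Z i w + ln (c i)) ^+ 2)%R])%E.
  apply: ae_eq_expectation; apply: filterS WZ => w [pWw WZ].
  apply: eq_bigr => i _; have e0 := posdef_eigval_gt0 i pWw.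
  by rewrite lnM ?posrE // addrC -WZ.
rewrite unlock; under eq_integral do rewrite -sumEFin.
rewrite ge0_integral_sum //; last by move=> i w _; rewrite lee_fin sqr_ge0.
  apply: eq_bigr => i _; have := @ae_eq_expectation _ _ _ P.
  rewrite unlock; apply; apply: filterS WZ => w [_ WZ].
  by rewrite WZ.
move=> i; apply/measurable_EFinP; apply: measurable_funX.
by apply: measurable_funD => //; exact: measurable_cst.
Qed.

Lemma variance_log_eigval_le i c :
  ('V_P[log_eigval W i] <= 'E_P[fun w => ((log_eigval W i w - c) ^+ 2)%R])%E.
Proof.
have [Z [mZ WZ]] := measurable_log_eigval_version.
(* The variances are centred at the expectations, so these must agree first. *)
have eZ : ('E_P[log_eigval W i] = 'E_P[Z i])%E.
  by apply: ae_eq_expectation; apply: filterS WZ => w [].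
have -> : ('V_P[log_eigval W i] = 'V_P[Z i])%E.
  rewrite !varianceEfine eZ.
  by apply: ae_eq_expectation; apply: filterS WZ => w [_ ->].
apply: le_trans (variance_le P c (mZ i)) _.
rewrite le_eqVlt; apply/orP; left; apply/eqP.
by apply: ae_eq_expectation; apply: filterS WZ => w [_ ->].
Qed.

End risk_decomposition.

Theorem theorem2 (R : realType) (p n : nat) (hp : (1 <= p)%N) (hpn : (p <= n)%N)
    (d : measure_display) (T : measurableType d) (P : probability T R)
    (A : T -> 'M[R]_p) (hA : wishart P n A 1%:M)
    (phi : 'M[R]_p -> 'M[R]_p)
    (hphi : measurable_fun setT (phi : borel_mx R p p -> borel_mx R p p))
    (hphiA : {ae P, forall w, posdef (phi (A w))}) :
  let W := fun w => phi (A w) in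
  let risk := geodesic_risk P W in
  let C := feasible P W in
  let dopt := optimal_scale P W in
  let V := (\sum_(i < p) 'V_P[log_eigval W i])%E in
  [/\ (forall c, C c -> (risk dopt <= risk c)%E),
      risk dopt = V &
      (C dopt -> minimum_on C risk dopt V)].
Proof.
move=> W risk C dopt V.
have mW : measurable_fun setT (W : T -> borel_mx R p p).
  exact: measurableT_comp hphi hA.1.
have dopt0 i : 0 < dopt i by exact: expR_gt0.
have doptE : risk dopt = V.
  rewrite /risk geodesic_riskE //; apply: eq_bigr => i _.
  (* The logarithm of [dopt i] is minus the centre that occurs in the variance. *)
  by rewrite /dopt /optimal_scale expRK varianceEfine.
have V_le c : C c -> (V <= risk c)%E.
  move=> [c0 _]; rewrite /risk geodesic_riskE //; apply: lee_sum => i _.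
  (* Scaling by [c i] amounts to centring [log_eigval W i] at [- ln (c i)]. *)
  by have := variance_log_eigval_le mW hphiA i (- ln (c i)); rewrite opprK.
split=> [c Cc| //| Cdopt]; first by rewrite doptE V_le.
by split.
Qed.
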